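(* Let $n\ge 1$. The set of type 3 signed arc permutations, $$\bigcup_{1\le l<k<n}\{\,-k\;\,-(k-1)\;\dots\;-(l+1)\ \sqcup\!\sqcup\ k+1\;\dots\;n\;\,1\;\dots\;l\,\}\subset B_n,$$ is in descent preserving bijection with the set of all standard domino tableaux of shapes $(a,2n-a-2,2)$, where $a$ ranges over the integers with $a\ge 2n-a-2\ge 2$.
   Context: $B_n$ is the hyperoctahedral group of all permutations $\pi$ of $\{-n,\dots,-1,0,1,\dots,n\}$ with $\pi(-i)=-\pi(i)$ for all $i$; $\pi$ is identified with the word $\pi(1)\cdots\pi(n)$. For $\pi\in B_n$, $Des(\pi)=\{0\le i\le n-1 \mid \pi(i)>\pi(i+1)\}$ (with $\pi(0)=0$). For two sequences $\alpha,\beta$, $\alpha\sqcup\!\sqcup\beta$ is the set of all sequences obtained by interleaving the letters of $\alpha$ and $\beta$ preserving the order of the letters of $\alpha$ and of $\beta$. Young diagrams are drawn with left-justified rows, row 1 on top. A standard domino tableau of shape $\lambda$, $\lambda$ a partition of $2n$, is a tiling of the Young diagram of $\lambda$ by $n$ dominoes ($1\times 2$ or $2\times 1$ rectangles) labelled bijectively by $\{1,\dots,n\}$, labels strictly increasing along rows and down columns (comparing distinct dominoes). A standard domino tableau $T$ has a descent in position $i$, $1\le i\le n-1$, if the domino labelled $i+1$ lies strictly below the domino labelled $i$ (all boxes of domino $i+1$ lie in rows strictly lower than all boxes of domino $i$), and has a descent in position $0$ if the domino labelled $1$ is vertical; $Des(T)$ is the set of its descents. A bijection $f$ from a set of signed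 permutations to a set of standard domino tableaux is descent preserving if $Des(f(\pi))=Des(\pi)$ for all $\pi$. *)

(* Defs.v *)
From HB Require Import structures.
From mathcomp Require Export all_boot all_order all_fingroup all_algebra.

Set Implicit Arguments.
Unset Strict Implicit.
Unset Printing Implicit Defensive.

(* The ordinal x : 'I_(n.*2.+1) stands for the integer x - n of {-n, ..., n};
   under this encoding integer negation is [rev_ord]. *)
Definition signed_val (n : nat) (x : 'I_(n.*2.+1)) : int :=
  (x%:Z - n%:Z)%R.

Definition hyperoctahedral (n : nat) : {set {perm 'I_(n.*2.+1)}} :=
  [set p : {perm 'I_(n.*2.+1)} | [forall x, p (rev_ord x) == rev_ord (p x)]].

(* The integer p(i); meaningful for 0 <= i <= n only. *)
Definition signed_at (n : nat) (p : {perm 'I_(n.*2.+1)}) (i : nat) : int :=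
  signed_val (p (inord (n + i))).

Definition signed_word (n : nat) (p : {perm 'I_(n.*2.+1)}) : seq int :=
  [seq signed_at p i | i <- iota 1 n].

Definition signed_Des (n : nat) (p : {perm 'I_(n.*2.+1)}) : {set 'I_n} :=
  [set i : 'I_n | (signed_at p i.+1 < signed_at p i)%R].

(* The mask m marks the positions of w occupied by the letters of s. *)
Definition is_shuffle (T : eqType) (s t w : seq T) : bool :=
  [exists m : (size w).-tuple bool,
     (mask m w == s) && (mask (map negb m) w == t)].

Definition neg_run (k l : nat) : seq int :=
  [seq (- (i%:Z))%R | i <- rev (index_iota l.+1 k.+1)].

Definition pos_run (n k l : nat) : seq int :=
  [seq i%:Z%R | i <- index_iota k.+1 n.+1 ++ index_iota 1 l.+1].

Definition type3_signed_arc (n : nat) : {set {perm 'I_(n.*2.+1)}} :=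
  \bigcup_(k < n) \bigcup_(l < k | 1 <= l)
    [set p in hyperoctahedral n |
       is_shuffle (neg_run k l) (pos_run n k l) (signed_word p)].

Definition is_partition_of (m : nat) (lam : seq nat) : bool :=
  [&& sorted geq lam, 0 \notin lam & sumn lam == m].

(* Boxes are pairs (row, column) counted from 0.  A partition of 2n has at most
   2n parts, all at most 2n, so its whole diagram lies in this square. *)
Definition box (n : nat) : finType := ('I_(n.*2) * 'I_(n.*2))%type.

Definition young_diagram (n : nat) (lam : seq nat) : {set box n} :=
  [set b : box n | b.2 < nth 0 lam b.1].

Definition horizontal_domino (n : nat) (D : {set box n}) : bool :=
  [exists b : box n, exists c : box n,
     [&& D == [set b; c], c.1 == b.1 & c.2 == b.2.+1 :> nat]].

Definition vertical_domino (n : nat) (D : {set box n}) : bool :=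
  [exists b : box n, exists c : box n,
     [&& D == [set b; c], c.1 == b.1.+1 :> nat & c.2 == b.2]].

(* T i is the set of boxes of the domino labelled i.+1. *)
Definition domino_filling (n : nat) : finType := {ffun 'I_n -> {set box n}}.

Definition domino_tiling (n : nat) (lam : seq nat) (T : domino_filling n) :
    bool :=
  [&& [forall i, horizontal_domino (T i) || vertical_domino (T i)],
      [forall i, forall j, (i != j) ==> [disjoint T i & T j]] &
      \bigcup_i T i == young_diagram n lam].

Definition labels_increasing (n : nat) (T : domino_filling n) : bool :=
  [forall i, forall j, forall b in T i, forall c in T j,
     (i != j) && ((b.1 == c.1) && (b.2 < c.2) || (b.2 == c.2) && (b.1 < c.1))
       ==> (i < j)].

Definition standard_domino_tableaux (n : nat) (lam : seq nat) :
    {set domino_filling n} :=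
  [set T : domino_filling n |
     [&& is_partition_of n.*2 lam, domino_tiling lam T & labels_increasing T]].

Definition strictly_below (n : nat) (E D : {set box n}) : bool :=
  [forall b in D, forall c in E, b.1 < c.1].

(* For i > 0 the dominoes labelled i and i.+1 are T (ord_pred i) and T i. *)
Definition domino_Des (n : nat) (T : domino_filling n) : {set 'I_n} :=
  [set i : 'I_n | if i == 0 :> nat then vertical_domino (T i)
                  else strictly_below (T i) (T (ord_pred i))].

(* The truncated subtractions are harmless: 2 <= n.*2 - a - 2 rules out
   truncation, and also forces a < n.*2. *)
Definition three_row_domino_tableaux (n : nat) : {set domino_filling n} :=
  \bigcup_(a < n.*2 | 2 <= n.*2 - a - 2 <= a)
    standard_domino_tableaux n [:: val a; n.*2 - a - 2; 2].

Definition descent_preserving_bijection (n : nat)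
    (A : {set {perm 'I_(n.*2.+1)}}) (B : {set domino_filling n})
    (f : {perm 'I_(n.*2.+1)} -> domino_filling n) : Prop :=
  [/\ {in A &, injective f}, f @: A = B &
      {in A, forall p, domino_Des (f p) = signed_Des p}].

(* Main.v *)
Require Import Defs.
From mathcomp Require Import zify.

Set Implicit Arguments.
Unset Strict Implicit.
Unset Printing Implicit Defensive.
Import Order.TTheory GRing.Theory Num.Theory.

(* Both sides are read letter by letter, so that their descents become a
   left-to-right statistic: a signed arc permutation is the word over {0,1,2}
   that tells negative letters (0), the letters 1..l (1) and the letters k+1..n
   (2) apart, and a tableau is the sequence of its dominoes, added one at a time
   to a Young diagram with three rows.  For a given descent set, let the count
   of a state be the number of ways to complete the object from that state.  By
   induction on the number of remaining letters these counts satisfy linear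
   relations between states of the two kinds, and the relation for the two
   initial states says that the descent sets are equidistributed.  A descent
   preserving bijection is then obtained fibre by fibre. *)

(** * From equal fibre sizes to a bijection *)

Lemma equal_fibres_bijection (X Y Z : finType) (A : {set X}) (B : {set Y})
    (dA : X -> Z) (dB : Y -> Z) (y0 : Y) :
  (forall z, #|[set x in A | dA x == z]| = #|[set y in B | dB y == z]|) ->
  exists f : X -> Y,
    [/\ {in A &, injective f}, f @: A = B & {in A, forall x, dB (f x) = dA x}].
Proof.
move=> eqAB.
pose EA z := enum [set x in A | dA x == z].
pose EB z := enum [set y in B | dB y == z].
have sizeE z : size (EA z) = size (EB z) by rewrite -!cardE eqAB.
have memA x : x \in A -> x \in EA (dA x) by move=> xA; rewrite mem_enum inE xA /=.
(* [f] sends an element of [A] to the element of the same rank in the fibre of [B] over the same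
   value; outside [A] it takes the value [y0]. *)
pose f x := nth y0 (EB (dA x)) (index x (EA (dA x))).
have fB x : x \in A -> f x \in EB (dA x).
  by move=> xA; rewrite mem_nth // -sizeE index_mem memA.
have dBf x : x \in A -> dB (f x) = dA x.
  by move=> /fB; rewrite mem_enum inE => /andP[_ /eqP].
have injf : {in A &, injective f}.
  move=> x y xA yA eqf; have eqd : dA x = dA y by rewrite -!dBf // eqf.
  have yE : y \in EA (dA x) by rewrite eqd memA.
  move/eqP: eqf; rewrite /f -eqd nth_uniq ?enum_uniq -?sizeE ?index_mem ?memA //.
  by move/eqP/(congr1 (nth x (EA (dA x)))); rewrite !nth_index // memA.
exists f; split=> //; apply/eqP; rewrite eqEcard; apply/andP; split.
  apply/subsetP=> _ /imsetP[x xA ->].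
  by have := fB x xA; rewrite mem_enum inE => /andP[].
rewrite (card_in_imset injf) -!sum1_card (partition_big dA predT) //=.
rewrite (partition_big dB predT) //= leq_sum // => z _.
by have := eqAB z; rewrite -!sum1dep_card => ->.
Qed.

(** * Counting words by descents *)

Record automaton (L : Type) := Automaton {
  state : Type;
  allowed : state -> L -> bool;
  next : state -> L -> state;
  descends : state -> L -> bool;
  final : pred state
}.

Fixpoint accepts L (M : automaton L) (q : state M) (w : seq L) : bool :=
  if w is x :: w' then allowed q x && accepts (next q x) w' else final q.

(* Bit i tells whether the letter in position i, counted from 0, creates a descent. *)
Fixpoint profile L (M : automaton L) (q : state M) (w : seq L) : seq bool :=
  if w is x :: w' then descends q x :: profile (next q x) w' else [::].

Fixpoint profile_count (L : finType) (M : automaton L) (q : state M)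
    (D : seq bool) : nat :=
  if D is d :: D' then
    \sum_x (if allowed q x && (descends q x == d)
            then profile_count (next q x) D' else 0)
  else final q.

Lemma size_profile L (M : automaton L) (q : state M) w :
  size (profile q w) = size w.
Proof. by elim: w q => //= x w IHw q; rewrite IHw. Qed.

Lemma card_tuple_cons (L : finType) n (P : pred (seq L)) :
  #|[set w : n.+1.-tuple L | P w]| = \sum_x #|[set w : n.-tuple L | P (x :: w)]|.
Proof.
rewrite -sum1dep_card (partition_big (@thead n L) predT) //=.
apply: eq_bigr => x _; rewrite -sum1dep_card.
rewrite (reindex_onto (fun w : n.-tuple L => [tuple of x :: w])
                      (fun w => [tuple of behead w])) /=.
  apply: eq_bigl => w; rewrite theadE eqxx andbT.
  by rewrite (_ : (_ == w)) ?andbT //; apply/eqP/val_inj.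
by move=> w /andP[_ /eqP <-]; rewrite -tuple_eta.
Qed.

Lemma card_profile (L : finType) (M : automaton L) n (q : state M) D :
  size D = n ->
  #|[set w : n.-tuple L | accepts q w && (profile q w == D)]|
    = profile_count q D.
Proof.
elim: n q D => [|n IHn] q [|d D] //= => [_|[sD]].
  have -> : [set w : 0.-tuple L | accepts q w && (profile q w == [::])]
            = if final q then setT else set0.
    by apply/setP=> w; rewrite inE tuple0 /= andbT; case: (final q); rewrite inE.
  by case: (final q); rewrite ?cards0 // cardsT card_tuple.
rewrite (card_tuple_cons n (fun w => accepts q w && (profile q w == d :: D))).
apply: eq_bigr => x _ /=.
case: ifPn => [/andP[qx qd]|ndx].
  rewrite -IHn //; apply: eq_card => w.
  by rewrite !inE qx /= eqseq_cons qd.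
apply/eqP; rewrite cards_eq0; apply/eqP/setP=> w; rewrite !inE.
apply: contraNF ndx => /andP[/andP[-> _]] /=.
by rewrite eqseq_cons => /andP[].
Qed.

(** * Linear relations between the completion counts *)

(* The state is the reversed prefix.  The head of the empty prefix is taken to be
   2 since position 0 of a signed permutation carries 0, which is above the
   negative letters and below the others. *)
Definition arc_automaton : automaton 'I_3 :=
  {| state := seq nat;
     allowed u (x : 'I_3) := ((x == 2 :> nat) ==> (1 \notin u)) && ((x == 1 :> nat) ==> (2 \in u));
     next u (x : 'I_3) := val x :: u;
     descends u (x : 'I_3) := x < head 2 u;
     final u := [&& 0 \in u, 1 \in u & 2 \in u] |}.

(* (r, v) is the domino whose top row is r; it is vertical when v holds. *)
Definition domino_step : finType := ('I_3 * bool)%type.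

Definition can_add (s : seq nat) (x : domino_step) : bool :=
  let: (r, v) := x in
  [&& r + v < 3, (r == 0 :> nat) || (nth 0 s r + (2 - v) <= nth 0 s r.-1)
    & v ==> (nth 0 s r == nth 0 s r.+1)].

Definition add_domino (s : seq nat) (x : domino_step) : seq nat :=
  let: (r, v) := x in incr_nth (incr_nth s r) (r + v).

(* The state consists of the row lengths and of the bottom row of the last domino. *)
Definition domino_automaton : automaton domino_step :=
  {| state := seq nat * option nat;
     allowed q (x : domino_step) := can_add q.1 x;
     next q (x : domino_step) := (add_domino q.1 x, Some (x.1 + x.2));
     descends q (x : domino_step) := if q.2 is Some r then r < x.1 else x.2;
     final q := nth 0 q.1 2 == 2 |}.

Lemma arc_count_cons (u : state arc_automaton) d D :
  profile_count u (d :: D) =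
    (if (0 < head 2 u) == d
     then profile_count (M := arc_automaton) (0 :: u) D else 0) +
    (if (2 \in u) && ((1 < head 2 u) == d)
     then profile_count (M := arc_automaton) (1 :: u) D else 0) +
    (if (1 \notin u) && ((2 < head 2 u) == d)
     then profile_count (M := arc_automaton) (2 :: u) D else 0).
Proof. by rewrite /= !big_ord_recl big_ord0 /= !andbT addn0 addnA. Qed.

Notation dcount s l := (profile_count (M := domino_automaton) (s, l)).
Notation acount u := (profile_count (M := arc_automaton) u).

(** The summands are the possible next dominoes: vertical in rows 0 and 1, horizontal in row 0,
    vertical in rows 1 and 2, horizontal in row 1, horizontal in row 2. *)
Lemma domino_count_cons a b c l d D :
  dcount [:: a; b; c] l (d :: D) =
    let des (r : nat) (v : bool) := (if l is Some r' then r' < r else v) == d in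
    (if (a == b) && des 0 true
     then dcount [:: a.+1; b.+1; c] (Some 1) D else 0) +
    (if des 0 false then dcount [:: a.+2; b; c] (Some 0) D else 0) +
    (if (b < a) && (b == c) && des 1 true
     then dcount [:: a; b.+1; c.+1] (Some 2) D else 0) +
    (if (b.+1 < a) && des 1 false
     then dcount [:: a; b.+2; c] (Some 1) D else 0) +
    (if (c.+1 < b) && des 2 false
     then dcount [:: a; b; c.+2] (Some 2) D else 0).
Proof.
rewrite [LHS]/=; set des := fun (r : nat) (v : bool) => _ == d.
pose F (r : 'I_3) v := if can_add [:: a; b; c] (r, v) && (des r v)
   then dcount (add_domino [:: a; b; c] (r, v)) (Some (r + v)) D else 0.
rewrite (eq_bigr (fun x : domino_step => F x.1 x.2)); last by case.
rewrite -(pair_bigA _ F) /= !big_ord_recl big_ord0 !big_bool /F /can_add /= !addn0.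
by rewrite /bump /= ?andbT ?addn1 ?addnS ?addn0 !addnA addn0.
Qed.

(* Once the third row is complete (resp. once the letter 1 has occurred and the
   letter 0 too), each step is a free choice between going up (a horizontal
   domino in row 0, resp. the letter 1) and going down; a descent is an up
   followed by a down. *)
Fixpoint free_count (up : bool) (D : seq bool) : nat :=
  if D is d :: D' then
    if d then (if up then free_count false D' else 0)
    else (if up then 0 else free_count false D') + free_count true D'
  else 1.

Lemma dcount_third_row_gt2 a b c l D : 2 < c -> dcount [:: a; b; c] l D = 0.
Proof.
elim: D a b c l => [|d D IHD] a b c l c2; first by case: c c2 => [|[|[|c]]].
by rewrite domino_count_cons /= !IHD ?if_same //; lia.
Qed.

(** A third row of length 1 can reach length 2 only by a vertical domino, which needs a second row
    of length 1; the second row is already too long and never shrinks. *)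
Lemma dcount_third_row_eq1 a b l D : 1 < b -> dcount [:: a; b; 1] l D = 0.
Proof.
elim: D a b l => [//|d D IHD] a b l b1.
rewrite domino_count_cons /= (_ : b == 1 = false) ?andbF; last by lia.
by rewrite (@dcount_third_row_gt2 _ _ 3) // !IHD ?if_same //; lia.
Qed.

Ltac split_ifs := repeat (case: ifP => ?).

(** Equal parity leaves exactly one way down: a vertical domino in rows 0 and 1 if [a = b], a
    horizontal one in row 1 otherwise. The last hypothesis makes a down after an up horizontal, so
    that it creates a descent. *)
Lemma dcount_free a b l D : 2 <= b <= a -> a %% 2 = b %% 2 -> l < 3 ->
  (l = 0 -> b + 2 <= a) ->
  dcount [:: a; b; 2] (Some l) D = free_count (l == 0) D.
Proof.
elim: D a b l => [//|d D IHD] a b l b2a pab l3 l0.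
rewrite domino_count_cons /= (@dcount_third_row_gt2 _ _ 3) // (@dcount_third_row_gt2 _ _ 4) // !if_same.
have up : dcount [:: a.+2; b; 2] (Some 0) D = free_count true D.
  by rewrite IHD //; lia.
have vert : a = b -> dcount [:: a.+1; b.+1; 2] (Some 1) D = free_count false D.
  by move=> e; rewrite IHD //; lia.
have down : b.+2 <= a -> dcount [:: a; b.+2; 2] (Some 1) D = free_count false D.
  by move=> e; rewrite IHD //; lia.
rewrite up /=.
case: l l3 l0 => [|[|[|l]]] // _ l0; case: d => /=; rewrite ?andbT ?andbF /=;
  split_ifs; rewrite ?vert ?down; lia.
Qed.

Lemma acount_free x u D : x < 2 -> 0 \in x :: u -> 1 \in x :: u -> 2 \in x :: u ->
  acount (x :: u) D = free_count (x == 1) D.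
Proof.
elim: D x u => [|d D IHD] x u x2 u0 u1 u2; first by rewrite /= u0 u1 u2.
rewrite arc_count_cons /= u1 u2 /= addn0 !IHD //;
  try by rewrite in_cons ?u0 ?u1 ?u2 orbT.
by case: x x2 {u0 u1 u2} => [|[|x]] // _; case: d => /=; rewrite ?addn0.
Qed.

(** The two conjuncts feed each other in the induction. Letters 2 and 0 match ups and downs, while
    the letter 1 and the domino filling the third row lead to free counts. The correction terms
    arise because after a 0 the letter 1 creates no descent, whereas a domino in row 2 after one
    ending in row 1 does. *)
Lemma acount_dcount_b2 D u a b : 1 \notin u ->
  2 <= b <= a -> a %% 2 = b %% 2 ->
  (0 \in u -> b + 2 <= a ->
   acount (2 :: u) D = dcount [:: a; b; 0] (Some 0) D) /\
  (2 \in u -> acount (0 :: u) D + free_count true D =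
    dcount [:: a; b; 0] (Some 1) D + free_count false D).
Proof.
elim: D u a b => [|d D IHD] u a b u1 b2a pab.
  by rewrite /= !in_cons (negPf u1) /= andbF.
have mark : dcount [:: a; b; 2] (Some 2) D = free_count false D.
  by rewrite dcount_free.
(* All continuations one letter or one domino later; the last two clauses are the two shapes of a
   down. *)
have step v : 0 \in v -> 2 \in v -> 1 \notin v ->
  [/\ acount (2 :: v) D = dcount [:: a.+2; b; 0] (Some 0) D,
      acount (1 :: v) D = free_count true D,
      a = b -> acount (0 :: v) D + free_count true D =
        dcount [:: a.+1; b.+1; 0] (Some 1) D + free_count false D &
      b.+2 <= a -> acount (0 :: v) D + free_count true D =
        dcount [:: a; b.+2; 0] (Some 1) D + free_count false D].
  move=> v0 v2 v1; split.
  - by have [|//|->//] := IHD v a.+2 b v1; lia.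
  - by rewrite acount_free // !in_cons ?v0 ?v2 orbT.
  - by move=> e; have [|//|_ ->] := IHD v a.+1 b.+1 v1; lia.
  - by move=> e; have [|//|_ ->] := IHD v a b.+2 v1; lia.
rewrite !arc_count_cons !domino_count_cons /= u1 /= mark.
split=> [u0 ab | u2].
  have [|||-> -> AV AH] := step (2 :: u); rewrite ?in_cons ?u0 //.
  case: d => /=; rewrite ?andbF ?andbT; split_ifs; lia.
have [|||-> -> AV AH] := step (0 :: u); rewrite ?in_cons ?u2 //.
case: d => /=; rewrite ?andbF ?andbT; split_ifs; lia.
Qed.

(** From rows (a, 1, 1) the third row is completed by a vertical domino in rows 1 and 2, which
    matches the first letter 0; a horizontal domino in row 1 would block the third row. Only the
    first conjunct is fed back into the induction. *)
Lemma acount_dcount_c1 D u a : 2 \in u -> 0 \notin u -> 2 <= a -> a %% 2 = 0 ->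
  acount (1 :: u) D = dcount [:: a; 1; 1] (Some 0) D /\
  acount (1 :: u) D + free_count false D =
    dcount [:: a; 1; 1] (Some 2) D + free_count true D.
Proof.
elim: D u a => [|d D IHD] u a u2 u0 a2 pa.
  by rewrite /= !in_cons (negPf u0).
have mark : dcount [:: a; 2; 2] (Some 2) D = free_count false D.
  by rewrite dcount_free //; lia.
have zero : acount [:: 0, 1 & u] D = free_count false D.
  by rewrite acount_free // !in_cons ?u2.
have [||||e _] := IHD (1 :: u) a.+2; rewrite ?in_cons //; try lia.
rewrite !arc_count_cons !domino_count_cons /= !in_cons u2 /= e zero mark.
rewrite (@dcount_third_row_eq1 a 3) //.
case: d => /=; rewrite ?andbF ?andbT; split_ifs; lia.
Qed.

(** The word side of [acount_dcount_b2] does not see [a] and [b], so comparing two shapes through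
    the same prefix [[:: 0; 2]] gives equal counts. *)
Lemma dcount_b2 D a b : 2 <= b <= a -> a %% 2 = b %% 2 ->
  (b + 2 <= a -> dcount [:: a; b; 0] (Some 0) D = dcount [:: 4; 2; 0] (Some 0) D)
  /\ dcount [:: a; b; 0] (Some 1) D = dcount [:: 2; 2; 0] (Some 1) D.
Proof.
move=> b2a pab.
have [//|//|//|e0 e1] := @acount_dcount_b2 D [:: 0; 2] a b.
have [//|//|//|e2 _] := @acount_dcount_b2 D [:: 0; 2] 4 2.
have [//|//|//|_ e3] := @acount_dcount_b2 D [:: 0; 2] 2 2.
split; last by have := e1 isT; have := e3 isT; lia.
by move=> ba; rewrite -e0 // -e2.
Qed.

(** This identity between tableau counts closes the induction of [acount_neg]: there a word
    continues with 0 or 2, a tableau with a vertical domino or a horizontal one in row 0, and only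
    the sums of the two continuations agree. *)
Lemma dcount_b1 D a : 3 <= a -> a %% 2 = 1 ->
  dcount [:: 4; 2; 0] (Some 0) D + dcount [:: 1; 1; 0] (Some 1) D =
  dcount [:: 2; 2; 0] (Some 1) D + dcount [:: a; 1; 0] (Some 0) D.
Proof.
elim: D a => [//|d D IHD] a a3 pa.
have e3 := IHD 3 isT erefl.
have [|//|e _] := @dcount_b2 D 6 2; first by [].
have [//|//|_ e33] := @dcount_b2 D 3 3.
have [//|//|_ e44] := @dcount_b2 D 4 4.
have ea : dcount [:: a; 3; 0] (Some 1) D = dcount [:: 2; 2; 0] (Some 1) D.
  by have [||_ ->] := @dcount_b2 D a 3; lia.
have up : dcount [:: a.+2; 1; 0] (Some 0) D = dcount [:: 3; 1; 0] (Some 0) D.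
  by have := IHD a.+2; lia.
(* The third row is completed from rows (2, 2, 0) for [b = 0] and from rows (4, 2, 0) for
   [b = 1]. *)
have mark b : b < 2 -> dcount [:: 2 + b.*2; 2; 2] (Some 2) D = free_count false D.
  by move=> b2; rewrite dcount_free //; lia.
rewrite !domino_count_cons /= e // e33 e44 ea up (mark 0) // (mark 1) //.
case: d => /=; rewrite ?andbF ?andbT; split_ifs; lia.
Qed.

Lemma acount_neg D u : 1 \notin u -> 2 \notin u ->
  acount (0 :: u) D = dcount [:: 1; 1; 0] (Some 1) D.
Proof.
elim: D u => [|d D IHD] u u1 u2; first by rewrite /= !in_cons (negPf u1).
have [//|//|//|e _] := @acount_dcount_b2 D (0 :: u) 4 2.
rewrite arc_count_cons domino_count_cons /= !in_cons (negPf u1) (negPf u2) /=.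
rewrite IHD ?in_cons // e //.
have := @dcount_b1 D 3 isT erefl.
case: d => /=; rewrite ?andbF ?andbT; split_ifs; lia.
Qed.

(** The continuations by 0 and by 1 match the horizontal domino in row 1 and the vertical one in
    rows 1 and 2 only up to free counts; both create descents, and in their sum the corrections
    cancel. *)
Lemma acount_pos D u a : 0 \notin u -> 1 \notin u -> 2 <= a -> a %% 2 = 0 ->
  acount (2 :: u) D = dcount [:: a; 0; 0] (Some 0) D.
Proof.
elim: D u a => [|d D IHD] u a u0 u1 a2 pa; first by rewrite /= !in_cons (negPf u0).
have [//|//|//|_ /(_ isT) eN] := @acount_dcount_b2 D (2 :: u) a 2.
have [//|//|//|//|_ eS] := @acount_dcount_c1 D (2 :: u) a.
rewrite arc_count_cons domino_count_cons /= !in_cons (negPf u1) /=.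
have -> : acount [:: 2, 2 & u] D = dcount [:: a.+2; 0; 0] (Some 0) D.
  by apply: IHD; rewrite ?in_cons //; lia.
case: d => /=; rewrite ?andbF ?andbT; split_ifs; lia.
Qed.

Lemma acount_dcount D :
  acount (Nil nat) D = dcount [:: 0; 0; 0] None D.
Proof.
case: D => [//|d D]; rewrite arc_count_cons domino_count_cons /=.
rewrite acount_neg // (@acount_pos D [::] 2) //.
by case: d => /=; rewrite ?addn0 ?add0n.
Qed.

(** * Tableaux as domino paths *)

Definition three_rows (s : seq nat) : bool :=
  (size s == 3) && (nth 0 s 2 <= nth 0 s 1 <= nth 0 s 0).

(** The column of the lower box of a vertical domino is read off the upper row; [can_add] forces
    both rows to have the same length. *)
Definition domino_cells (s : seq nat) (x : domino_step) : seq (nat * nat) :=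
  let: (r, v) := x in
  [:: (val r, nth 0 s r); (r + v, nth 0 s r + ~~ v)].

Lemma three_rows_noninc s i j : three_rows s -> i <= j -> nth 0 s j <= nth 0 s i.
Proof.
case: s => [|a [|b [|c []]]] //; rewrite /three_rows /=.
by case: i j => [|[|[|i]]] [|[|[|j]]] /=; rewrite ?nth_nil; lia.
Qed.

Lemma three_rows_add s x : three_rows s -> can_add s x ->
  three_rows (add_domino s x).
Proof.
case: s => [|a [|b [|c []]]] //; case: x => [[[|[|[|r]]] //= lt3] []];
  rewrite /three_rows /=; lia.
Qed.

Lemma sumn_add s x : three_rows s -> can_add s x ->
  sumn (add_domino s x) = sumn s + 2.
Proof.
case: s => [|a [|b [|c []]]] //; case: x => [[[|[|[|r]]] //= lt3] []] //=; lia.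
Qed.

Lemma mem_domino_cells s x i j : three_rows s -> can_add s x ->
  ((i, j) \in domino_cells s x) = (nth 0 s i <= j < nth 0 (add_domino s x) i).
Proof.
case: s => [|a [|b [|c []]]] //; case: x => [[[|[|[|r]]] //= lt3] []] //=;
  rewrite /three_rows !inE !xpair_eqE; case: i => [|[|[|i]]] /=;
  rewrite ?nth_nil; lia.
Qed.

Lemma domino_cells_inj s x y :
  domino_cells s x =i domino_cells s y -> x = y.
Proof.
move: x y => [r v] [r' v'] eqc.
have := eqc (val r, nth 0 s r); have := eqc (val r', nth 0 s r').
have := eqc (r + v, nth 0 s r + ~~ v).
rewrite !inE !eqxx !orbT !xpair_eqE /=.
case: (r =P r') => [<-|/eqP ne]; first by case: v v' {eqc} => [] [] //=; lia.
have {ne} : val r != val r' by [].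
case: v v' {eqc} => [] [] //=; lia.
Qed.

Definition path_state (w : seq domino_step) : seq nat :=
  foldl add_domino [:: 0; 0; 0] w.

Fixpoint domino_path (s : seq nat) (w : seq domino_step) : bool :=
  if w is x :: w' then can_add s x && domino_path (add_domino s x) w' else true.

Lemma accepts_domino s l w :
  accepts (M := domino_automaton) (s, l) w =
    domino_path s w && (nth 0 (foldl add_domino s w) 2 == 2).
Proof. by elim: w s l => //= x w IHw s l; rewrite IHw andbA. Qed.

Lemma domino_path_rcons s w x :
  domino_path s (rcons w x) = domino_path s w && can_add (foldl add_domino s w) x.
Proof. by elim: w s => [|y w IHw] s /=; rewrite ?andbT // IHw andbA. Qed.

Lemma domino_path_take s w i : domino_path s w -> domino_path s (take i w).
Proof. by elim: w s i => [|x w IHw] s [|i] //= /andP[->]; apply: IHw. Qed.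

Lemma three_rows_path w : domino_path [:: 0; 0; 0] w ->
  three_rows (path_state w) /\ sumn (path_state w) = (size w).*2.
Proof.
elim/last_ind: w => [//|w x IHw]; rewrite domino_path_rcons => /andP[/IHw[s3 ss] wx].
rewrite /path_state foldl_rcons size_rcons; split; first exact: three_rows_add.
by rewrite (sumn_add s3 wx) [sumn _]ss; lia.
Qed.

Lemma path_state_take_step w i x0 : i < size w ->
  domino_path [:: 0; 0; 0] w ->
  can_add (path_state (take i w)) (nth x0 w i) /\
  path_state (take i.+1 w) = add_domino (path_state (take i w)) (nth x0 w i).
Proof.
move=> iw /(domino_path_take i.+1); rewrite (take_nth x0) // domino_path_rcons.
by case/andP=> _ ->; rewrite /path_state foldl_rcons.
Qed.

Lemma nth_add_domino s x j : nth 0 s j <= nth 0 (add_domino s x) j.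
Proof. by case: x => r v; rewrite /= !nth_incr_nth; lia. Qed.

Lemma path_state_take_mono w i j r : i <= j ->
  nth 0 (path_state (take i w)) r <= nth 0 (path_state (take j w)) r.
Proof.
move=> /subnKC <-; elim: (j - i) => [|k IHk]; first by rewrite addn0.
apply: leq_trans IHk _; rewrite addnS; case: (ltnP (i + k) (size w)) => iw.
  have x0 : domino_step by case: (w) iw.
  by rewrite (take_nth x0) // /path_state foldl_rcons nth_add_domino.
by rewrite !take_oversize // leqW.
Qed.

Definition tableau_of n (w : n.-tuple domino_step) : domino_filling n :=
  [ffun i : 'I_n => [set b : box n |
     (val b.1, val b.2) \in domino_cells (path_state (take i w)) (tnth w i)]].

Section TableauOfPath.

Variables (n : nat) (w : n.-tuple domino_step).
Hypothesis pathw : domino_path [:: 0; 0; 0] w.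

Let st i := path_state (take i w).

Let st_rows i : three_rows (st i) /\ sumn (st i) = (minn i n).*2.
Proof.
by have [] := three_rows_path (domino_path_take i pathw); rewrite size_take_min size_tuple.
Qed.

Let step_ok (i : 'I_n) :
  can_add (st i) (tnth w i) /\ st i.+1 = add_domino (st i) (tnth w i).
Proof.
have x0 := tnth w i; rewrite (tnth_nth x0).
by apply: path_state_take_step; rewrite ?size_tuple.
Qed.

(** Each domino is the difference of two consecutive shapes of an increasing chain; disjointness,
    covering and monotonicity of labels all come from this. *)
Lemma mem_tableau_of (i : 'I_n) (b : box n) :
  (b \in tableau_of w i) = (nth 0 (st i) b.1 <= b.2 < nth 0 (st i.+1) b.1).
Proof.
have [ok ->] := step_ok i; have [s3 _] := st_rows i.
by rewrite ffunE inE mem_domino_cells.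
Qed.

(** The shapes on the path are partitions of at most 2n, hence have at most 2n rows and columns and
    fit in the ambient square. *)
Lemma domino_cells_box (i : 'I_n) c :
  c \in domino_cells (path_state (take i w)) (tnth w i) ->
  exists b : box n, (val b.1, val b.2) = c.
Proof.
case: c => r k; have [ok eqs] := step_ok i; have [s3 _] := st_rows i.
rewrite mem_domino_cells // -eqs => /andP[_ lt].
have [s3' su] := st_rows i.+1.
have [r2 k2] : r < n.*2 /\ k < n.*2.
  have := ltn_ord i; move: s3' su lt; rewrite /three_rows.
  by case: (st i.+1) => [|a [|b [|c []]]] //=; case: r => [|[|[|r]]] /=;
     rewrite ?nth_nil; lia.
by exists (Ordinal r2, Ordinal k2).
Qed.

Lemma tableau_of_cells (i : 'I_n) : exists b c : box n,
  [/\ tableau_of w i = [set b; c],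
      b.1 = (tnth w i).1 :> nat /\ b.2 = nth 0 (st i) (tnth w i).1 :> nat &
      c.1 = (tnth w i).1 + (tnth w i).2 :> nat /\
      c.2 = nth 0 (st i) (tnth w i).1 + ~~ (tnth w i).2 :> nat].
Proof.
have := @domino_cells_box i; have : forall b, (b \in tableau_of w i) =
  ((val b.1, val b.2) \in domino_cells (st i) (tnth w i)).
  by move=> b; rewrite ffunE inE.
case: (tnth w i) => r v memT cb.
have [|b eb] := cb (val r, nth 0 (st i) r); first by rewrite inE eqxx.
have [|c ec] := cb (r + v, nth 0 (st i) r + ~~ v); first by rewrite !inE eqxx orbT.
exists b, c; split; [|by case: eb|by case: ec].
apply/setP=> z; rewrite memT !inE -eb -ec.
by case: z {memT} => z1 z2; case: b {eb} => b1 b2; case: c {ec} => c1 c2.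
Qed.

Lemma tableau_of_tiling : domino_tiling (path_state w) (tableau_of w).
Proof.
apply/and3P; split.
- apply/forallP=> i; have [b [c [-> [b1 b2] [c1 c2]]]] := tableau_of_cells i.
  case E : (tnth w i).2 in c1 c2.
    apply/orP; right; apply/existsP; exists b; apply/existsP; exists c.
    by rewrite eqxx /= -[X in _ && X](inj_eq val_inj) /= c1 b1 c2 b2; lia.
  apply/orP; left; apply/existsP; exists b; apply/existsP; exists c.
  by rewrite eqxx /= -[X in X && _](inj_eq val_inj) /= c1 b1 c2 b2; lia.
- apply/forallP=> i; apply/forallP=> j; apply/implyP=> neij.
  rewrite -setI_eq0; apply/eqP/setP=> b; rewrite !inE !mem_tableau_of.
  apply/negP; have /orP[lt|lt] : (i < j) || (j < i) by rewrite -neq_ltn.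
    have := path_state_take_mono w b.1 lt; rewrite /st; lia.
  have := path_state_take_mono w b.1 lt; rewrite /st; lia.
- apply/eqP/setP=> b; rewrite inE -[in RHS](take_oversize (n := n) (s := w)) ?size_tuple //.
  rewrite -/(st n).
  apply/bigcupP/idP => [[i _]|].
    rewrite mem_tableau_of => /andP[_ lt]; apply: leq_trans lt _.
    exact: path_state_take_mono.
  have : nth 0 (st 0) b.1 <= b.2 by rewrite /st take0 /=; case: (val b.1) => [|[|[|?]]] //=; rewrite nth_nil.
  (* A box of the final shape belongs to the domino of the first step whose shape contains it. *)
  move=> b0 bn; have exm : exists m, b.2 < nth 0 (st m) b.1 by exists n.
  case: (ex_minnP exm) => [[|m] ltm minm]; first by lia.
  have ltmn : m < n by apply: minm.
  exists (Ordinal ltmn) => //; rewrite mem_tableau_of /= ltm andbT leqNgt.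
  by apply/negP => /minm; rewrite ltnn.
Qed.

(** If [j] came before [i], the box [c] would lie in the shape reached before step [i]; so would
    [b], which is weakly above and to the left, although step [i] adds it. *)
Lemma tableau_of_increasing : labels_increasing (tableau_of w).
Proof.
apply/forallP=> i; apply/forallP=> j; apply/forall_inP=> b bi.
apply/forall_inP=> c cj; apply/implyP=> /andP[neij le_bc].
rewrite ltnNge leq_eqVlt negb_or eq_sym neij /=; apply/negP=> ltji.
have := path_state_take_mono w c.1 ltji; have [] := st_rows i.
move: bi cj; rewrite !mem_tableau_of /st.
move=> bi cj s3 _.
have lebc : b.1 <= c.1 /\ b.2 <= c.2.
  by move: le_bc; rewrite -!(inj_eq val_inj) /=; lia.
have := three_rows_noninc s3 lebc.1; lia.
Qed.

Lemma strictly_below_tableau_of (i j : 'I_n) :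
  strictly_below (tableau_of w j) (tableau_of w i) =
    ((tnth w i).1 + (tnth w i).2 < (tnth w j).1).
Proof.
have [b [c [-> [b1 b2] [c1 c2]]]] := tableau_of_cells i.
have [d [e [-> [d1 d2] [e1 e2]]]] := tableau_of_cells j.
apply/forall_inP/idP => [below|lt y].
  have /forall_inP/(_ d) := below c (set22 _ _).
  by rewrite set21 c1 d1 => /(_ isT).
rewrite !inE => yb; apply/forall_inP=> z; rewrite !inE => zd.
by case/orP: yb => /eqP->; case/orP: zd => /eqP->; lia.
Qed.

Lemma vertical_tableau_of (i : 'I_n) :
  vertical_domino (tableau_of w i) = (tnth w i).2.
Proof.
have [b [c [-> [b1 b2] [c1 c2]]]] := tableau_of_cells i.
apply/idP/idP => [|v].
  case/existsP=> b' /existsP[c' /and3P[/eqP eqbc /eqP bc1 _]].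
  have := set21 b' c'; have := set22 b' c'; rewrite -eqbc !inE.
  by case/orP=> /eqP ?; case/orP=> /eqP ?; subst; lia.
apply/existsP; exists b; apply/existsP; exists c.
by rewrite eqxx /= -[X in _ && X](inj_eq val_inj) /= c1 b1 c2 b2 v; lia.
Qed.

End TableauOfPath.

Lemma nth_profile_domino s l w x0 i : i < size w ->
  nth false (profile (M := domino_automaton) (s, l) w) i =
    let x := nth x0 w i in
    if i is k.+1 then (nth x0 w k).1 + (nth x0 w k).2 < x.1
    else if l is Some r then r < x.1 else x.2.
Proof.
elim: w s l i => [//|y w IHw] s l [|i] //= iw; rewrite IHw //.
by case: i iw.
Qed.

Lemma mem_domino_Des n (w : n.-tuple domino_step) (i : 'I_n) :
  domino_path [:: 0; 0; 0] w ->
  (i \in domino_Des (tableau_of w)) =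
    nth false (profile (M := domino_automaton) ([:: 0; 0; 0], None) w) i.
Proof.
move=> pathw; rewrite inE strictly_below_tableau_of // vertical_tableau_of //.
have x0 := tnth w i; rewrite (nth_profile_domino _ _ x0) ?size_tuple //.
rewrite !(tnth_nth x0) /=.
case: i => [[|i] lti] //=.
(* [ord_pred] is computed modulo [n], which changes nothing at a positive position. *)
by rewrite (_ : (i.+1 + n).-1 %% n = i) //; rewrite addSn /= modnDr modn_small // ltnW.
Qed.

(** Once the earlier steps agree, the shape before the current step is known and its domino
    determines the step. *)
Lemma tableau_of_inj n (w w' : n.-tuple domino_step) :
  domino_path [:: 0; 0; 0] w -> domino_path [:: 0; 0; 0] w' ->
  tableau_of w = tableau_of w' -> w = w'.
Proof.
move=> pw pw' eqT; apply: val_inj => /=.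
suff eqt i : i <= n -> take i w = take i w'.
  by have := eqt n (leqnn n); rewrite !take_oversize ?size_tuple.
elim: i => [|i IHi] lti; first by rewrite !take0.
have x0 := tnth w (Ordinal lti).
rewrite !(take_nth x0) ?size_tuple // IHi ?(ltnW lti) //; congr rcons.
rewrite -!(tnth_nth x0 _ (Ordinal lti)).
pose s := path_state (take i w).
have es : path_state (take i w') = s by rewrite /s IHi ?(ltnW lti).
apply: (@domino_cells_inj s) => c; apply/idP/idP => hc.
  have [b eb] := domino_cells_box pw (i := Ordinal lti) hc.
  have : b \in tableau_of w (Ordinal lti) by rewrite ffunE inE eb.
  by rewrite eqT ffunE inE eb /= es.
have hc' : c \in domino_cells (path_state (take i w')) (tnth w' (Ordinal lti)).
  by rewrite es.
have [b eb] := domino_cells_box pw' (i := Ordinal lti) hc'.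
have : b \in tableau_of w' (Ordinal lti) by rewrite ffunE inE eb.
by rewrite -eqT ffunE inE eb.
Qed.

(** Since labels increase, the dominoes with the m smallest labels fill a Young diagram for every m,
    so adding them in order is a path. The last clause compares shapes inside the square only, which
    is what the tiling controls. *)
Lemma path_of_tableau n lam (T : domino_filling n) : size lam <= 3 ->
  T \in standard_domino_tableaux n lam ->
  exists w : n.-tuple domino_step,
    [/\ domino_path [:: 0; 0; 0] w, tableau_of w = T &
        forall b : box n, (b.2 < nth 0 (path_state w) b.1) = (b.2 < nth 0 lam b.1)].
Proof.
move=> lam3; rewrite inE => /and3P[/and3P[lamS _ _] /and3P[/forallP domT disjT /eqP covT] incT].
have lamI r r' : r <= r' -> nth 0 lam r' <= nth 0 lam r.
  move=> rr'; case: (ltnP r' (size lam)) => [lt|/(nth_default 0)-> //].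
  have geqT : transitive geq by move=> x y z /=; lia.
  apply: (sorted_leq_nth geqT (leqnn : reflexive geq) 0 lamS) => //.
  by rewrite inE (leq_ltn_trans rr').
have inlam (b : box n) : (b.2 < nth 0 lam b.1) = [exists i, b \in T i].
  move/setP/(_ b): covT; rewrite inE => <-.
  by apply/bigcupP/existsP => [[i _]|[i]]; exists i.
have distinct i j (b : box n) : b \in T i -> b \in T j -> i = j.
  move=> bi bj; apply/eqP/negPn/negP => neij.
  have := forallP (forallP disjT i) j; rewrite neij /= => /pred0P/(_ b).
  by rewrite /= bi bj.
have before i j (b c : box n) : b \in T i -> c \in T j -> i != j ->
   (b.1 == c.1) && (b.2 < c.2) || (b.2 == c.2) && (b.1 < c.1) -> i < j.
  move=> bi cj neij bc.
  move/forallP/(_ i)/forallP/(_ j)/forall_inP/(_ b bi): incT.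
  by move=> /forall_inP/(_ c cj); rewrite neij bc.
have x0 : domino_step := (ord0, false).
have build m : m <= n -> exists w : seq domino_step,
   [/\ size w = m, domino_path [:: 0; 0; 0] w,
     forall (i : 'I_n) (b : box n), i < m -> (b \in T i) =
       ((val b.1, val b.2) \in domino_cells (path_state (take i w)) (nth x0 w i)) &
     forall b : box n, (b.2 < nth 0 (path_state w) b.1) =
       [exists i : 'I_n, (i < m) && (b \in T i)]].
  elim: m => [_|m IHm ltmn].
    exists [::]; split=> // b.
    rewrite [path_state _]/= (_ : nth _ _ _ = 0); last first.
      by case: (val b.1) => [|[|[|r]]] //=; rewrite nth_nil.
    by rewrite ltn0; symmetry; apply/existsP => [[i]].
  have [w [sw pw Tw Uw]] := IHm (ltnW ltmn).
  pose k := Ordinal ltmn; pose s := path_state w.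
  have s3 : three_rows s by have [] := three_rows_path pw.
  have fresh (b : box n) : b \in T k -> nth 0 s b.1 <= b.2.
    move=> bk; rewrite leqNgt Uw; apply/existsP => [[i /andP[im bi]]].
    by rewrite (distinct _ _ _ bi bk) /= ltnn in im.
  (* A box left of the domino [k] or above it lies in the diagram of [lam], hence in a domino with a
     smaller label. *)
  have lower (z y : box n) : z \in T k -> y \notin T k ->
     (y.1 == z.1) && (y.2 < z.2) || (y.2 == z.2) && (y.1 < z.1) ->
     y.2 < nth 0 s y.1.
    move=> zk yk yz; have : z.2 < nth 0 lam z.1.
      by rewrite inlam; apply/existsP; exists k.
    move=> zlam; have : y.2 < nth 0 lam y.1.
      case/orP: yz => /andP[/eqP-> lt]; first exact: ltn_trans zlam.
      exact: leq_trans (lamI _ _ (ltnW lt)).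
    rewrite inlam => /existsP[j yj]; rewrite Uw; apply/existsP; exists j.
    rewrite yj andbT; apply: (before _ _ _ _ yj zk _ yz).
    by apply: contra yk => /eqP<-.
  have row3 (z : box n) : z \in T k -> z.1 < 3.
    move=> zk; have : z.2 < nth 0 lam z.1 by rewrite inlam; apply/existsP; exists k.
    by apply: contraTltn => z3; rewrite nth_default // (leq_trans lam3).
  suff [x okx Tx] : exists2 x, can_add s x & forall b : box n, (b \in T k) =
      ((val b.1, val b.2) \in domino_cells s x).
    exists (rcons w x); split.
    - by rewrite size_rcons sw.
    - by rewrite domino_path_rcons pw.
    - move=> i b; rewrite ltnS leq_eqVlt => /orP[/eqP eim|ltim].
        rewrite (_ : i = k); last exact: val_inj.
        by rewrite nth_rcons /= sw ltnn eqxx -cats1 take_size_cat // Tx.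
      by rewrite nth_rcons sw ltim -cats1 takel_cat ?sw 1?ltnW // Tw.
    - move=> b; rewrite /path_state foldl_rcons -/(path_state w) -/s.
      have := Tx b; have := Uw b; have := nth_add_domino s x b.1.
      rewrite -/s mem_domino_cells // => mono eU eT.
      apply/idP/existsP => [lt|[i]].
        case: (ltnP b.2 (nth 0 s b.1)) => [|ge].
          rewrite eU => /existsP[i /andP[lti bi]]; exists i.
          by rewrite bi ltnW.
        by exists k; rewrite eT ge lt /= ltnSn.
      rewrite ltnS leq_eqVlt => /andP[/orP[/eqP eim|ltim] bi].
        by move: bi; rewrite (_ : i = k) ?eT => [/andP[]//|]; apply: val_inj.
      apply: leq_trans mono; rewrite eU; apply/existsP; exists i.
      by rewrite ltim.
  (* Otherwise the first free box of the row would lie further left and be filled by [lower]. *)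
  have flush (z : box n) : z \in T k ->
      (forall y : box n, y \in T k -> y.1 = z.1 -> z.2 <= y.2) ->
      z.2 = nth 0 s z.1 :> nat.
    move=> zk zmin; apply/eqP; rewrite eqn_leq fresh // andbT leqNgt.
    apply/negP=> lt; pose y : box n := (z.1, Ordinal (ltn_trans lt (ltn_ord z.2))).
    have yk : y \notin T k by apply/negP => /zmin/(_ erefl) /=; rewrite leqNgt lt.
    by have := lower z y zk yk; rewrite eqxx /= lt /= ltnn => /(_ isT).
  have above (z : box n) : z \in T k ->
      (forall y : box n, y \in T k -> y.2 = z.2 -> z.1 <= y.1) ->
      (z.1 == 0 :> nat) || (z.2 < nth 0 s z.1.-1).
    move=> zk zmin; case E : (val z.1) => [|r] //=.
    have ltr : r < z.1 by rewrite [X in _ < X]E.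
    pose y : box n := (Ordinal (ltn_trans ltr (ltn_ord z.1)), z.2).
    have yk : y \notin T k by apply/negP => /zmin/(_ erefl) /=; rewrite leqNgt ltr.
    by have := lower z y zk yk; rewrite eqxx /= ltr /= orbT => /(_ isT).
  case/orP: (domT k) => /existsP[[b1 b2] /existsP[[c1 c2] /and3P[/eqP eT /= /eqP e1 /eqP e2]]].
    subst c1; have bk : (b1, b2) \in T k by rewrite eT set21.
    have ck : (b1, c2) \in T k by rewrite eT set22.
    have fb : b2 = nth 0 s b1 :> nat.
      apply: flush bk _ => y; rewrite eT !inE => /orP[] /eqP-> //=.
      by rewrite e2.
    have ac : (b1 == 0 :> nat) || (c2 < nth 0 s b1.-1).
      by apply: above ck _ => y; rewrite eT !inE => /orP[] /eqP-> //=.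
    exists (Ordinal (row3 _ bk), false).
      by rewrite /can_add /= addn0 (row3 _ bk) /= andbT -fb addn2 -e2.
    by case=> z1 z2; rewrite eT !inE !xpair_eqE /= -fb addn0 addn1 -e2.
  subst c2; have bk : (b1, b2) \in T k by rewrite eT set21.
  have ck : (c1, b2) \in T k by rewrite eT set22.
  have fb : b2 = nth 0 s b1 :> nat.
    by apply: flush bk _ => y; rewrite eT !inE => /orP[] /eqP-> //=.
  have fc : b2 = nth 0 s c1 :> nat.
    by apply: flush ck _ => y; rewrite eT !inE => /orP[] /eqP-> //=.
  have ab : (b1 == 0 :> nat) || (b2 < nth 0 s b1.-1).
    apply: above bk _ => y; rewrite eT !inE => /orP[] /eqP-> //=.
    by rewrite e1.
  exists (Ordinal (row3 _ bk), true).
    rewrite /can_add /= addn1 -e1 (row3 _ ck) /= -fb -fc eqxx andbT.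
    by rewrite (_ : b2 + (2 - true) = b2.+1) // subn1 addn1.
  by case=> z1 z2; rewrite eT !inE !xpair_eqE /= -fb addn0 addn1 -e1.
have [w [sw pw Tw Uw]] := build n (leqnn n).
exists (tcast sw (in_tuple w)); split.
- by rewrite val_tcast.
- apply/ffunP=> i; apply/setP=> b; rewrite ffunE inE Tw //.
  by rewrite (tnth_nth x0) val_tcast.
- move=> b; rewrite val_tcast Uw inlam; apply: eq_existsb => i.
  by rewrite ltn_ord.
Qed.

Lemma three_row_domino_tableauxP n (T : domino_filling n) :
  reflect (exists2 w : n.-tuple domino_step,
             accepts (M := domino_automaton) ([:: 0; 0; 0], None) w &
             T = tableau_of w)
          (T \in three_row_domino_tableaux n).
Proof.
apply: (iffP bigcupP) => [[a /andP[a2 aa] Tlam]|[w]].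
  have [//|w [pw <- eqd]] := path_of_tableau _ Tlam.
  exists w => //; rewrite accepts_domino pw /=.
  (* The boxes of row 2 in columns 1 and 2 exist, and together they test that the third row has
     length 2. *)
  have r2 : 2 < n.*2 by have := ltn_ord a; lia.
  have c1 : 1 < n.*2 by exact: ltnW.
  have := eqd (Ordinal r2, Ordinal c1); have := eqd (Ordinal r2, Ordinal r2).
  by rewrite /= /path_state; case: (nth 0 _ 2) => [|[|[|c]]].
rewrite accepts_domino => /andP[pw /eqP s2] ->.
have [s3 su] := three_rows_path pw.
have := tableau_of_tiling pw; have := tableau_of_increasing pw.
move: s2 s3 su; rewrite -/(path_state w) size_tuple.
case: (path_state w) => [|a [|b [|c []]]] //= -> /andP[_ /= ba] su inc til.
have lta : a < n.*2 by lia.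
exists (Ordinal lta); first by rewrite /=; lia.
rewrite inE /= (_ : n.*2 - a - 2 = b); last by lia.
rewrite til inc /is_partition_of /= !inE; lia.
Qed.

(** * Arc permutations as words *)

(* The next negative, small and large letters to be written are -k, b and c. *)
Fixpoint letter_values (k b c : nat) (w : seq 'I_3) : seq int :=
  if w is x :: w' then
    if x == 0 :> nat then (- k%:Z)%R :: letter_values k.-1 b c w'
    else if x == 1 :> nat then Posz b :: letter_values k b.+1 c w'
    else Posz c :: letter_values k b c.+1 w'
  else [::].

Definition letter_count (w : seq 'I_3) (x : nat) : nat :=
  count (fun y : 'I_3 => y == x :> nat) w.

Arguments letter_count : simpl never.

Definition negatives (w : seq 'I_3) : seq bool :=
  [seq x == 0 :> nat | x : 'I_3 <- w].

(** The positive run lists the large letters before the small ones. *)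
Definition no_12 (w : seq 'I_3) : bool := ~~ subseq [:: 1; 2] [seq val x | x <- w].

Lemma size_letter_values k b c w : size (letter_values k b c w) = size w.
Proof.
by elim: w k b c => //= x w IHw k b c; case: ifP => _; [|case: ifP => _]; rewrite /= IHw.
Qed.

Lemma letter_count_cons (x : 'I_3) w y :
  letter_count (x :: w) y = (x == y :> nat) + letter_count w y.
Proof. by []. Qed.

Lemma letter_count_sum w :
  letter_count w 0 + letter_count w 1 + letter_count w 2 = size w.
Proof.
elim: w => //= x w IHw; rewrite !letter_count_cons.
by case: x => [[|[|[|x]]] ltx] //=; lia.
Qed.

Lemma has_letter w y : (y \in [seq val x | x : 'I_3 <- w]) = (0 < letter_count w y).
Proof.
elim: w => //= x w IHw; rewrite in_cons IHw letter_count_cons eq_sym.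
by case: (_ == _).
Qed.

Lemma no_12_cons (x : 'I_3) w :
  no_12 (x :: w) = no_12 w && ((x == 1 :> nat) ==> (letter_count w 2 == 0)).
Proof.
rewrite /no_12 [map _ _]/=; case: x => [[|[|[|x]]] ltx] //=; rewrite ?andbT //.
rewrite sub1seq has_letter lt0n negbK.
have: subseq [:: 1; 2] [seq val x | x : 'I_3 <- w] -> letter_count w 2 != 0.
  by move=> /mem_subseq/(_ 2); rewrite -lt0n -has_letter !inE => ->.
by case: (subseq _ _) => [/(_ isT)/negPf->|].
Qed.

(** All 2s precede all 1s and both must occur, so demanding a 2 before the first 1 loses no word.
    The hypothesis holds in every reachable state. *)
Lemma accepts_arc (u : state arc_automaton) w : (1 \in u) ==> (2 \in u) ->
  accepts u w =
    [&& (0 \in u) || (0 < letter_count w 0), (1 \in u) || (0 < letter_count w 1),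
        (2 \in u) || (0 < letter_count w 2),
        (1 \in u) ==> (letter_count w 2 == 0) & no_12 w].
Proof.
elim: w u => [|x w IHw] u u12; first by rewrite /= !orbF implybT !andbT.
rewrite no_12_cons !letter_count_cons /=.
case: x => [[|[|[|x]]] ltx] //=; rewrite ?add0n ?andbT.
- by rewrite IHw ?in_cons //= orbT.
- case u2: (2 \in u) => /=; last first.
    by rewrite (lt0n (letter_count w 2)); case: eqP; rewrite ?andbF.
  rewrite IHw ?in_cons ?u2 //= orbT.
  by case: (1 \in u); case: (letter_count w 2 == 0); rewrite ?andbF ?andbT.
- case u1: (1 \in u) => /=; first by rewrite !andbF.
  by rewrite IHw ?in_cons ?u1 //= orbT.
Qed.

Lemma accepts_arc0 w : accepts (M := arc_automaton) [::] w =
  [&& 0 < letter_count w 0, 0 < letter_count w 1, 0 < letter_count w 2 & no_12 w].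
Proof. by rewrite accepts_arc. Qed.

Lemma neg_run_cons k l : l <= k -> neg_run k.+1 l = (- (k.+1)%:Z)%R :: neg_run k l.
Proof.
move=> lk; rewrite /neg_run /index_iota !subSS subSn // -[(k - l).+1]addn1.
by rewrite iotaD rev_cat /= addSn subnKC.
Qed.

Lemma neg_run_nil k : neg_run k k = [::].
Proof. by rewrite /neg_run /index_iota subnn. Qed.

Lemma mask_negatives k b c w : letter_count w 0 <= k ->
  mask (negatives w) (letter_values k b c w) = neg_run k (k - letter_count w 0).
Proof.
elim: w k b c => [|x w IHw] k b c; first by rewrite subn0 neg_run_nil.
rewrite letter_count_cons /=; case: ifP => /= [_|_] ltk; last by case: ifP => _; exact: IHw.
by case: k ltk => // k ltk; rewrite IHw // -neg_run_cons ?leq_subr.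
Qed.

Lemma mask_positives k b c w : no_12 w ->
  mask (map negb (negatives w)) (letter_values k b c w) =
    [seq Posz i | i <- iota c (letter_count w 2) ++ iota b (letter_count w 1)].
Proof.
elim: w k b c => [//|x w IHw] k b c.
rewrite no_12_cons => /andP[/IHw{}IHw]; rewrite !letter_count_cons.
case: x => [[|[|[|x]]] ltx] //=; last by rewrite IHw.
by move/eqP=> w2; rewrite IHw w2.
Qed.

Lemma letter_values_of_masks v m k b c i j h : size m = size v ->
  i <= k -> mask m v = neg_run k (k - i) ->
  mask (map negb m) v = [seq Posz x | x <- iota c j ++ iota b h] ->
  exists w : seq 'I_3, [/\ v = letter_values k b c w, no_12 w
    & [/\ letter_count w 0 = i, letter_count w 1 = h & letter_count w 2 = j]].
Proof.
elim: v m k b c i j h => [|x v IHv] [|[] m] //= k b c i j h => [_ ik e1 e2|[sm] ik|[sm] ik e1].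
- exists [::]; split=> //.
  have := congr1 size e1; have := congr1 size e2.
  rewrite /neg_run !size_map size_cat !size_iota size_rev size_iota /=.
  by rewrite /letter_count /=; split; lia.
- case: i k ik => [|i] [|k] // ik; rewrite ?subn0 ?neg_run_nil //.
  rewrite subSS neg_run_cons ?leq_subr // => -[-> e1] e2.
  have [w [-> w12 [w0 w1 w2]]] := IHv _ k _ _ i _ _ sm ik e1 e2.
  by exists ((ord0 : 'I_3) :: w); rewrite no_12_cons w12 !letter_count_cons w0 w1 w2.
case: j => [|j] /=.
  case: h => [//|h] /= [-> e2].
  have [w [-> w12 [w0 w1 w2]]] := IHv _ k _ c _ 0 _ sm ik e1 e2.
  by exists ((@Ordinal 3 1 isT) :: w); rewrite no_12_cons w12 !letter_count_cons w0 w1 w2.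
move=> [-> e2].
have [w [-> w12 [w0 w1 w2]]] := IHv _ _ _ _ _ _ _ sm ik e1 e2.
by exists ((@Ordinal 3 2 isT) :: w); rewrite no_12_cons w12 !letter_count_cons w0 w1 w2.
Qed.

Definition arc_values (w : seq 'I_3) : seq int :=
  let k := letter_count w 0 + letter_count w 1 in letter_values k 1 k.+1 w.

Lemma is_shuffleP (T : eqType) (s t v : seq T) :
  reflect (exists m, [/\ size m = size v, mask m v = s & mask (map negb m) v = t])
          (is_shuffle s t v).
Proof.
apply: (iffP existsP) => [[m /andP[/eqP ms /eqP mt]]|[m [sm ms mt]]].
  by exists m; rewrite size_tuple.
by exists (tcast sm (in_tuple m)); rewrite val_tcast /= ms mt !eqxx.
Qed.

(** The letters 0, 1 and 2 occur k - l, l and n - k times, so 1 <= l < k < n says that each of them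
    occurs. *)
Lemma type3_signed_arcP n (p : {perm 'I_(n.*2.+1)}) :
  p \in type3_signed_arc n <->
  p \in hyperoctahedral n /\ exists2 w : n.-tuple 'I_3,
    accepts (M := arc_automaton) [::] w & signed_word p = arc_values w.
Proof.
split.
  case/bigcupP=> k _ /bigcupP[l l1]; rewrite inE => /andP[hp /is_shuffleP[m [sm m1 m2]]].
  split=> //.
  have lk := ltn_ord l; have kn := ltn_ord k.
  have e1 : mask m (signed_word p) = neg_run k (k - (k - l)) by rewrite subKn // ltnW.
  have [|w [ew w12 [w0 w1 w2]]] := letter_values_of_masks sm _ e1 m2; first exact: leq_subr.
  have sw : size w = n.
    by move/(congr1 size): ew; rewrite size_letter_values size_map size_iota.
  exists (tcast sw (in_tuple w)); rewrite val_tcast /=.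
    by rewrite accepts_arc0 w0 w1 w2 w12; lia.
  by rewrite ew /arc_values w0 w1 (_ : k - l + _ = k) //; lia.
case=> hp [w]; rewrite accepts_arc0 => /and4P[w0 w1 w2 w12] ew.
have sw := letter_count_sum w; rewrite size_tuple in sw.
set k := letter_count w 0 + letter_count w 1 in ew.
have kn : k < n by lia.
apply/bigcupP; exists (Ordinal kn) => //.
have lk : letter_count w 1 < k by lia.
apply/bigcupP; exists (Ordinal lk) => //.
rewrite inE hp /=; apply/is_shuffleP; exists (negatives w); split.
- by rewrite !size_map size_tuple size_iota.
- by rewrite ew mask_negatives ?leq_addr // /k addKn.
- rewrite ew mask_positives // /pos_run /index_iota subSS subn1 /=.
  by rewrite (_ : n - k = letter_count w 2) //; lia.
Qed.

(** * Signed permutations with a prescribed word *)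

Lemma perm_mask_negb (T : eqType) m (v : seq T) : size m = size v ->
  perm_eq v (mask m v ++ mask (map negb m) v).
Proof.
elim: v m => [|x v IHv] [|[] m] //= [sm]; first by rewrite perm_cons IHv.
by rewrite perm_sym perm_catC /= perm_cons perm_catC perm_sym IHv.
Qed.

Lemma perm_arc_values (w : seq 'I_3) : no_12 w ->
  perm_eq [seq `|z|%N | z <- arc_values w] (iota 1 (size w)).
Proof.
move=> w12; set k := letter_count w 0 + letter_count w 1.
have sw : size (negatives w) = size (arc_values w).
  by rewrite size_letter_values size_map.
apply: perm_trans (perm_map _ (perm_mask_negb sw)) _.
rewrite mask_negatives ?leq_addr // addKn mask_positives // map_cat -!map_comp.
have -> : [seq (absz \o Posz) i | i <- iota k.+1 (letter_count w 2) ++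
    iota 1 (letter_count w 1)] =
    iota k.+1 (letter_count w 2) ++ iota 1 (letter_count w 1) by rewrite map_id.
rewrite (eq_map (g := id)) => [|i]; last by rewrite /= abszN.
rewrite map_id /index_iota subSS addnK -(letter_count_sum w) -/k.
rewrite /k [_ + letter_count w 1]addnC !iotaD !add1n.
apply/seq.permP => a; rewrite !count_cat count_rev; lia.
Qed.

Lemma signed_word_exists n (v : seq int) :
  perm_eq [seq `|z|%N | z <- v] (iota 1 n) ->
  exists2 p : {perm 'I_(n.*2.+1)}, p \in hyperoctahedral n & signed_word p = v.
Proof.
move=> pv; have sv : size v = n by have := perm_size pv; rewrite size_map size_iota.
have range i : i < n -> 0 < `|nth 0%R v i| <= n.
  move=> ltin; have : `|nth 0%R v i| \in iota 1 n.
    by rewrite -(perm_mem pv) map_f ?mem_nth ?sv.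
  by rewrite mem_iota; lia.
have inj i j : i < n -> j < n -> `|nth 0%R v i| = `|nth 0%R v j| -> i = j.
  move=> lti ltj; rewrite -!(nth_map 0%R 0) ?sv // => /eqP.
  by rewrite nth_uniq ?size_map ?sv // ?(perm_uniq pv) ?iota_uniq // => /eqP.
(* The odd extension of [v], with indices shifted by [n] so that [n] stands for 0. *)
pose val_at (x : nat) : int :=
  if x == n then 0%R else if n < x then nth 0%R v (x - n.+1)
    else (- nth 0 v (n - x.+1)%N)%R.
have val0 : val_at n = 0%R by rewrite /val_at eqxx.
have val_pos i : val_at (n + i.+1) = nth 0%R v i.
  rewrite /val_at (_ : _ == n = false); last by lia.
  by rewrite (_ : n < n + i.+1) 1?(_ : n + i.+1 - n.+1 = i) //; lia.
have val_neg i : i < n -> val_at (n - i.+1) = (- nth 0 v i)%R.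
  move=> ltin; rewrite /val_at (_ : _ == n = false); last by lia.
  rewrite (_ : n < n - i.+1 = false); last by lia.
  by rewrite (_ : n - (n - i.+1).+1 = i) //; lia.
clearbody val_at.
have cases x : x < n.*2.+1 ->
    [\/ x = n, exists2 i, i < n & x = n + i.+1 | exists2 i, i < n & x = n - i.+1].
  move=> ltx; case: (ltngtP x n) => xn; [constructor 3|constructor 2|by constructor 1].
    by exists (n - x.+1); lia.
  by exists (x - n.+1); lia.
have val_range x : x < n.*2.+1 -> `|val_at x| <= n.
  by case/cases => [->|[i /[dup]/range ri lti ->]|[i /[dup]/range ri lti ->]];
    rewrite ?val0 ?val_pos ?val_neg // ?abszN; lia.
have val_at_inj x y : x < n.*2.+1 -> y < n.*2.+1 -> val_at x = val_at y -> x = y.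
  case/cases => [->|[i lti ->]|[i lti ->]]; case/cases => [->|[j ltj ->]|[j ltj ->]];
    rewrite ?val0 ?val_pos ?val_neg //; try have := range i lti;
    try have := range j ltj; try have := inj i j lti ltj; try lia;
    by move=> ij rj ri e; have eij : i = j by [apply: ij; lia]; subst j; lia.
have val_opp x : x < n.*2.+1 -> val_at (n.*2 - x) = (- val_at x)%R.
  case/cases => [->|[i lti ->]|[i lti ->]].
  - by rewrite -addnn addnK val0 oppr0.
  - by rewrite (_ : n.*2 - (n + i.+1) = n - i.+1) ?val_pos ?val_neg //; lia.
  - by rewrite (_ : n.*2 - (n - i.+1) = n + i.+1) ?val_pos ?val_neg // ?opprK //; lia.
(* By [val_range] the shifted value lies between 0 and 2n, so neither the absolute value nor [inord]
   alters it. *)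
pose f (x : 'I_(n.*2.+1)) : 'I_(n.*2.+1) := inord `|(val_at x + n%:Z)%R|.
have val_f (x : 'I_(n.*2.+1)) : (f x : nat)%:Z%R = (val_at x + n%:Z)%R.
  have := val_range x (ltn_ord x); rewrite /f; move: (val_at x) => z zn.
  by rewrite inordK; lia.
have f_inj : injective f.
  move=> x y fxy; apply/ord_inj/val_at_inj => //.
  by apply: (addIr (Posz n)); rewrite -!val_f fxy.
exists (perm f_inj).
  rewrite inE; apply/forallP=> x; rewrite !permE; apply/eqP/val_inj => /=.
  have := val_f (rev_ord x); have := val_f x; have := ltn_ord (f x).
  by rewrite /= subSS val_opp //; lia.
apply: (@eq_from_nth _ 0%R); rewrite size_map size_iota ?sv // => i lti.
rewrite (nth_map 0) ?size_iota // nth_iota // add1n /signed_at /signed_val permE.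
by rewrite val_f inordK ?val_pos ?addrK //; lia.
Qed.

Lemma signed_word_inj n (p q : {perm 'I_(n.*2.+1)}) :
  p \in hyperoctahedral n -> q \in hyperoctahedral n ->
  signed_word p = signed_word q -> p = q.
Proof.
rewrite !inE => /forallP hp /forallP hq eqw.
have pos (x : 'I_(n.*2.+1)) : n < x -> p x = q x.
  move=> ltx; have lti : x - n.+1 < n by have := ltn_ord x; lia.
  have := congr1 (fun v => nth 0%R v (x - n.+1)) eqw.
  rewrite !(nth_map 0) ?size_iota // !nth_iota // /signed_at /signed_val.
  rewrite (_ : n + (1 + (x - n.+1)) = x); last by lia.
  by rewrite inord_val => eqv; apply: val_inj => /=; lia.
apply/permP => x; case: (ltngtP x n) => xn; last 1 first.
- have xr : rev_ord x = x by apply: val_inj => /=; lia.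
  have /eqP/(congr1 val) := hp x; have /eqP/(congr1 val) := hq x; rewrite xr /= => e1 e2.
  apply: val_inj => /=; have := ltn_ord (p x); have := ltn_ord (q x); lia.
- apply: rev_ord_inj; rewrite -(eqP (hp x)) -(eqP (hq x)); apply: pos => /=; lia.
- exact: pos.
Qed.

(** * Descents of arc permutations *)

Lemma signed_at0 n (p : {perm 'I_(n.*2.+1)}) :
  p \in hyperoctahedral n -> signed_at p 0 = 0%R.
Proof.
rewrite inE => /forallP/(_ (inord n)).
have -> : rev_ord (inord n : 'I_(n.*2.+1)) = inord n.
  by apply: val_inj; rewrite /= inordK; lia.
rewrite /signed_at /signed_val addn0 => /eqP/(congr1 val) /= e.
have := ltn_ord (p (inord n)); lia.
Qed.

Lemma signed_at_word n (p : {perm 'I_(n.*2.+1)}) i :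
  p \in hyperoctahedral n -> i <= n ->
  signed_at p i = nth 0%R (0%R :: signed_word p) i.
Proof.
case: i => [|i] hp lti; first exact: signed_at0.
by rewrite /= (nth_map 0) ?size_iota // nth_iota.
Qed.

(** Negative, small and large letters are ordered as 0 < 1 < 2, and values rise within each class,
    so descents depend on the classes alone. Here [v] is the value preceding the word; the last two
    hypotheses place it relative to the values still to come. *)
Lemma profile_letter_values (u : state arc_automaton) (v : int) k b c w :
  accepts u w -> head 2 u < 3 -> letter_count w 0 <= k -> 0 < b -> b + letter_count w 1 <= c ->
  (2 \in u -> (b%:Z + (letter_count w 1)%:Z <= v)%R \/ head 2 u < 2) ->
  (if head 2 u == 0 then v = - (k.+1)%:Z
   else if head 2 u == 1 then v = b%:Z - 1 else 0 <= v < c%:Z)%R ->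
  profile u w = pairmap (fun x y : int => (y < x)%R) v (letter_values k b c w).
Proof.
elim: w u v k b c => [//|x w IHw] u v k b c /= /andP[ux accw].
rewrite !letter_count_cons; case: x ux accw => [[|[|[|x]]] ltx] //=; rewrite ?add0n.
- move=> _ accw hu ck b0 cb uv uh; congr cons; last first.
    apply: IHw => //; rewrite /= ?in_cons /=; try lia.
  by move: uh; case: (head 2 u) => [|[|h]] /=; lia.
- move=> u2 accw hu ck b0 cb uv uh; congr cons; last first.
    apply: IHw => //=; rewrite ?in_cons /=; try lia.
  by have := uv u2; move: uh; case: (head 2 u) => [|[|h]] /=; lia.
move=> /andP[u1 _] accw hu ck b0 cb uv uh; congr cons; last first.
  apply: IHw => //=; try lia.
by move: uh u1 hu; case: u {accw uv} => [|[|[|[|h]]] u] //=; lia.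
Qed.
Lemma profile_arc_values (w : seq 'I_3) :
  accepts (M := arc_automaton) [::] w ->
  profile (M := arc_automaton) [::] w =
    pairmap (fun x y : int => (y < x)%R) 0%R (arc_values w).
Proof. by move=> accw; apply: profile_letter_values => //=; lia. Qed.

Lemma mem_signed_Des n (p : {perm 'I_(n.*2.+1)}) (w : n.-tuple 'I_3) (i : 'I_n) :
  p \in hyperoctahedral n -> accepts (M := arc_automaton) [::] w ->
  signed_word p = arc_values w ->
  (i \in signed_Des p) = nth false (profile (M := arc_automaton) [::] w) i.
Proof.
move=> hp accw ew; rewrite inE profile_arc_values // -ew !signed_at_word //; last exact: ltnW.
by rewrite (nth_pairmap 0%R) // size_map size_iota.
Qed.

Lemma letter_values_lt0 k b c w : letter_count w 0 <= k ->
  [seq (z < 0)%R | z <- letter_values k b c w] = negatives w.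
Proof.
elim: w k b c => //= x w IHw k b c; rewrite letter_count_cons.
case: x => [[|[|[|x]]] ltx] //= ck; rewrite IHw //; try lia.
by congr cons; lia.
Qed.

(** The sign recognises the letter 0, and [d] separates the values of letters 1, below [d], from
    those of letters 2, at least [c]. *)
Lemma letter_values_inj k b c d w w' : letter_count w 0 <= k -> letter_count w' 0 <= k ->
  b + letter_count w 1 <= d -> b + letter_count w' 1 <= d -> d <= c ->
  letter_values k b c w = letter_values k b c w' -> w = w'.
Proof.
elim: w w' k b c => [|x w IHw] [|y w'] k b c //=; try by do 2?case: ifP.
rewrite !letter_count_cons.
case: x => [[|[|[|x]]] ltx] //=; case: y => [[|[|[|y]]] lty] //= k1 k2 b1 b2 dc [];
  try lia; try (move=> e1 e2; exfalso; lia).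
  all: move=> /IHw-> //; try lia; congr cons; exact: val_inj.
Qed.

Lemma arc_values_inj w w' : accepts (M := arc_automaton) [::] w ->
  accepts (M := arc_automaton) [::] w' -> arc_values w = arc_values w' -> w = w'.
Proof.
rewrite !accepts_arc0 => /and4P[w0 _ _ _] /and4P[w0' _ _ _] eqv.
pose top (u : seq 'I_3) := letter_count u 0 + letter_count u 1.
(* The first negative entry is -k, so k can be read off the values. *)
have neg_hd (u : seq 'I_3) : 0 < letter_count u 0 ->
    head 0%R (mask [seq (z < 0)%R | z <- arc_values u] (arc_values u)) = (- (top u)%:Z)%R.
  move=> u0; rewrite letter_values_lt0 ?mask_negatives ?leq_addr // -/(top u).
  have : letter_count u 0 <= top u by rewrite leq_addr.
  by case: (top u) => [|k] uk; [lia | rewrite neg_run_cons //; lia].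
have ek : top w = top w'.
  by have := neg_hd _ w0; rewrite eqv neg_hd //; lia.
move: eqv; rewrite /arc_values -/(top w) -/(top w') ek.
by apply: (@letter_values_inj _ _ _ (top w').+1); rewrite /top in ek *; lia.
Qed.

(** * Comparison of the fibres *)

Lemma set_of_profile n (A : {set 'I_n}) (s : seq bool) (D : {set 'I_n}) :
  size s = n -> (forall i : 'I_n, (i \in A) = nth false s i) ->
  (A == D) = (s == [seq i \in D | i <- enum 'I_n]).
Proof.
move=> ss As; apply/eqP/eqP => [<-|es].
  apply: (@eq_from_nth _ false) => [|i]; rewrite ss 1?size_map ?size_enum_ord // => lti.
  by rewrite (nth_map (Ordinal lti)) ?size_enum_ord // As nth_enum_ord.
apply/setP=> i; rewrite As es (nth_map i) ?size_enum_ord //.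
by rewrite nth_ord_enum.
Qed.

Lemma card_fibre (X : finType) (L : finType) (M : automaton L) (q : state M) n
    (A : {set X}) (Des : X -> {set 'I_n}) (h : n.-tuple L -> X) :
  {in [pred w : n.-tuple L | accepts q w] &, injective h} ->
  (forall x, reflect (exists2 w : n.-tuple L, accepts q w & x = h w) (x \in A)) ->
  (forall (w : n.-tuple L) i, accepts q w ->
     (i \in Des (h w)) = nth false (profile q w) i) ->
  forall D, #|[set x in A | Des x == D]| =
    profile_count q [seq i \in D | i <- enum 'I_n].
Proof.
move=> hinj hA hDes D.
have sD : size [seq i \in D | i <- enum 'I_n] = n by rewrite size_map size_enum_ord.
rewrite -(card_profile q sD).
have eqD (w : n.-tuple L) : accepts q w ->
    (Des (h w) == D) = (profile q w == [seq i \in D | i <- enum 'I_n]).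
  by move=> qw; apply: set_of_profile => [|i]; rewrite ?size_profile ?size_tuple ?hDes.
rewrite -[RHS](card_in_imset (f := h)); last first.
  by move=> w w'; rewrite !inE => /andP[qw _] /andP[qw' _]; exact: hinj.
apply: eq_card => x; rewrite inE; apply/andP/imsetP => [[/hA[w qw ->]]|[w]].
  by rewrite eqD // => ew; exists w; rewrite // inE qw.
rewrite inE => /andP[qw ew] ->; split; last by rewrite eqD.
by apply/hA; exists w.
Qed.

Definition arc_permutation n (w : n.-tuple 'I_3) : {perm 'I_(n.*2.+1)} :=
  odflt 1%g [pick p in hyperoctahedral n | signed_word p == arc_values w].

Lemma arc_permutationP n (w : n.-tuple 'I_3) : accepts (M := arc_automaton) [::] w ->
  arc_permutation w \in hyperoctahedral n /\
  signed_word (arc_permutation w) = arc_values w.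
Proof.
rewrite accepts_arc0 => /and4P[_ _ _ w12]; rewrite /arc_permutation.
case: pickP => [p /andP[hp /eqP ep] //|none].
have := perm_arc_values w12; rewrite size_tuple => /signed_word_exists[p hp ep].
by have := none p; rewrite hp ep eqxx.
Qed.

Theorem proposition10 (n : nat) (hn : 1 <= n) :
  exists f : {perm 'I_(n.*2.+1)} -> domino_filling n,
    descent_preserving_bijection
      (type3_signed_arc n) (three_row_domino_tableaux n) f.
Proof.
(* Both fibres over [D] are counted by [card_fibre], and [acount_dcount] equates the counts. The
   constant filling is the default value off the arc permutations. *)
apply: (@equal_fibres_bijection _ _ _ _ _ _ _ [ffun=> set0]) => D.
rewrite (card_fibre (M := arc_automaton) (q := [::]) (h := @arc_permutation n)).
- rewrite acount_dcount.
  rewrite (card_fibre (M := domino_automaton) (q := ([:: 0; 0; 0], None))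
             (h := @tableau_of n)) //.
  + move=> w w'; rewrite !inE !accepts_domino => /andP[pw _] /andP[pw' _].
    exact: tableau_of_inj.
  + exact: three_row_domino_tableauxP.
  + by move=> w i; rewrite accepts_domino => /andP[pw _]; exact: mem_domino_Des.
- move=> w w'; rewrite !inE => aw aw' eqp; apply/val_inj/arc_values_inj => //.
  by rewrite -(arc_permutationP aw).2 eqp (arc_permutationP aw').2.
- move=> p; apply: (iffP idP) => [/type3_signed_arcP[hp [w aw ew]]|[w aw ->]].
    exists w => //; have [hq eq] := arc_permutationP aw.
    by apply: signed_word_inj; rewrite // eq.
  apply/type3_signed_arcP; have [hp ep] := arc_permutationP aw.
  by split=> //; exists w.
- move=> w i aw; have [hp ep] := arc_permutationP aw.
  exact: mem_signed_Des.
Qed.
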